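(* There exists a mixed manna instance $(\mathcal N,\mathcal M,(v_i)_{i\in\mathcal N})$ for which no $\alpha$-MMS allocation exists for any $\alpha\in(0,1]$. In particular, for any fixed $\alpha\in(0,1]$, an $\alpha$-MMS allocation of a mixed manna may not exist.
   Context: An instance consists of a finite set $\mathcal N$ of $n$ agents, a finite set $\mathcal M$ of indivisible items, and for each agent $i$ an additive valuation $v_i:2^{\mathcal M}\to\mathbb R$, $v_i(S)=\sum_{j\in S}v_{ij}$, with $v_{ij}$ of arbitrary sign (mixed manna). An allocation is a partition $A=(A_i)_{i\in\mathcal N}$ of all of $\mathcal M$ into $n$ (possibly empty) bundles, $A_i$ going to agent $i$; $\Pi_n(\mathcal M)$ is the set of allocations. $\mathrm{MMS}_i=\max_{(A_1,\dots,A_n)\in\Pi_n(\mathcal M)}\min_{k\in[n]}v_i(A_k)$. For $\alpha\in(0,1]$, $A$ is $\alpha$-MMS if for all $i$: $v_i(A_i)\ge\alpha\,\mathrm{MMS}_i$ when $\mathrm{MMS}_i\ge0$, and $v_i(A_i)\ge(1/\alpha)\mathrm{MMS}_i$ when $\mathrm{MMS}_i<0$. *)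

(* Defs.v *)
From mathcomp Require Import all_boot all_order all_algebra.
From mathcomp Require Import reals.

Set Implicit Arguments.
Unset Strict Implicit.
Unset Printing Implicit Defensive.

Import Order.TTheory GRing.Theory Num.Theory.
Local Open Scope ring_scope.

(* An instance is given by a finite type N of agents, a finite type M of
   items, and values v : N -> M -> R of arbitrary sign. *)

Definition bundle_value (R : realType) (M : finType) (w : M -> R)
  (S : {set M}) : R := \sum_(j in S) w j.

(* Bundles may be empty, so [partition] of finset.v, which rules out set0,
   does not apply. *)
Definition is_allocation (N M : finType) (A : {ffun N -> {set M}}) : bool :=
  [forall k, forall l, (k != l) ==> [disjoint A k & A l]]
  && (\bigcup_k A k == [set: M]).

(* R has no greatest or least element to serve as the value of an empty min or
   max, so each operator below starts from a value that already belongs to its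
   range: the bundle with label i for the min, and the allocation giving all
   items to i for the max. *)
Definition min_bundle_value (R : realType) (N M : finType) (i : N)
  (w : M -> R) (A : {ffun N -> {set M}}) : R :=
  \big[Num.min/bundle_value w (A i)]_(k : N) bundle_value w (A k).

Definition all_to (N M : finType) (i : N) : {ffun N -> {set M}} :=
  [ffun k => if k == i then [set: M] else set0].

(* The n bundles of a maximin partition are labelled by the n agents. *)
Definition MMS (R : realType) (N M : finType) (v : N -> M -> R) (i : N) : R :=
  \big[Num.max/min_bundle_value i (v i) (all_to M i)]_(A | is_allocation A)
    min_bundle_value i (v i) A.

Definition is_alpha_MMS (R : realType) (N M : finType) (v : N -> M -> R)
  (alpha : R) (A : {ffun N -> {set M}}) : Prop :=
  forall i : N,
    (0 <= MMS v i -> alpha * MMS v i <= bundle_value (v i) (A i)) /\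
    (MMS v i < 0 -> alpha^-1 * MMS v i <= bundle_value (v i) (A i)).

Lemma all_to_allocation (N M : finType) (i : N) : is_allocation (all_to M i).
Proof.
apply/andP; split.
  apply/forallP => k; apply/forallP => l; apply/implyP => kl; rewrite !ffunE.
  case: (k =P i) kl => [->|_] kl; last by rewrite -setI_eq0 set0I.
  by rewrite eq_sym in kl; rewrite (negbTE kl) -setI_eq0 setI0.
apply/eqP/setP => j; rewrite inE; apply/bigcupP; exists i => //.
by rewrite ffunE eqxx inE.
Qed.

Lemma min_bundle_value_spec (R : realType) (N M : finType) (i : N)
  (w : M -> R) (A : {ffun N -> {set M}}) :
  (exists k, min_bundle_value i w A = bundle_value w (A k)) /\
  (forall k, min_bundle_value i w A <= bundle_value w (A k)).
Proof.
split; last by move=> k; apply: bigmin_le_cond.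
rewrite /min_bundle_value; elim/big_ind: _ => [|x y [k ->] [l ->]|k _].
- by exists i.
- by case: leP => _; [exists k | exists l].
- by exists k.
Qed.

Lemma MMS_spec (R : realType) (N M : finType) (v : N -> M -> R) (i : N) :
  (exists2 A, is_allocation A & MMS v i = min_bundle_value i (v i) A) /\
  (forall A, is_allocation A -> min_bundle_value i (v i) A <= MMS v i).
Proof.
split; last by move=> A hA; apply: le_bigmax_cond.
rewrite /MMS; elim/big_ind: _ => [|x y [A hA ->] [B hB ->]|A hA].
- by exists (all_to M i) => //; apply: all_to_allocation.
- by case: leP => _; [exists B | exists A].
- by exists A.
Qed.

(* Main.v *)
(** Three agents share ten items. Agent [i] values item [j] at [11 b_j + p_ij],
    where the base values [b] sum to 0 and a subset of the items never has
    [p_i]-value above 11. If everybody receives a positive value, then all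
    bundles have nonnegative, hence zero, base value. The vector [b] has
    exactly three partitions into three nonempty bundles of zero base value, one
    for each agent. The perturbation [p_i] is worth 2 on each bundle of the
    partition of agent [i], so that [MMS_i >= 2]. On the partition of agent [i],
    the other two agents have positive value only for one bundle, the same for
    both. Hence every allocation gives some agent a value [<= 0], while all
    maximin shares are positive. *)

Require Import Defs.
From mathcomp Require Import all_boot all_order all_algebra.
From mathcomp Require Import reals.
From mathcomp Require Import zify.

Import Order.TTheory GRing.Theory Num.Theory.
Local Open Scope ring_scope.

(** Covering gives each item an owner, and disjointness makes it unique. *)
Lemma allocation_owner {N M : finType} {A : {ffun N -> {set M}}} :
  is_allocation A -> exists f : M -> N, forall i j, (j \in A i) = (f j == i).
Proof.
case/andP => /forallP disA /eqP covA.
have owned j : exists i, j \in A i.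
  have : j \in \bigcup_k A k by rewrite covA inE.
  by case/bigcupP => i _ ji; exists i.
exists (fun j => xchoose (owned j)) => i j.
have jf := xchooseP (owned j).
apply/idP/eqP => [ji|<- //]; apply/eqP/negPn/negP => ne.
have /implyP/(_ ne) := forallP (disA (xchoose (owned j))) i.
by move/disjointFr/(_ jf); rewrite ji.
Qed.

Lemma owner_allocation {N M : finType} (f : M -> N) :
  is_allocation [ffun i => [set j | f j == i]].
Proof.
apply/andP; split.
  apply/forallP => k; apply/forallP => l; apply/implyP => kl; rewrite !ffunE.
  rewrite -setI_eq0; apply/eqP/setP => j; rewrite !inE.
  by apply/negP => /andP[/eqP-> /eqP e]; rewrite e eqxx in kl.
apply/eqP/setP => j; rewrite inE; apply/bigcupP; exists (f j) => //.
by rewrite ffunE inE.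
Qed.

Lemma sum_allocation {N M : finType} {A : {ffun N -> {set M}}}
    {V : zmodType} (w : M -> V) :
  is_allocation A -> \sum_i \sum_(j in A i) w j = \sum_j w j.
Proof.
case/allocation_owner => f Af; rewrite [RHS](partition_big f xpredT) //=.
by apply: eq_bigr => i _; apply: eq_bigl => j; rewrite Af.
Qed.

Lemma MMS_ge {R : realType} {N M : finType} (v : N -> M -> R) (i : N) (c : R)
    {A : {ffun N -> {set M}}} :
  is_allocation A -> (forall k, c <= bundle_value (v i) (A k)) -> c <= MMS v i.
Proof.
move=> allocA cA; apply: le_trans ((MMS_spec v i).2 A allocA).
by have [[k ->] _] := min_bundle_value_spec i (v i) A; apply: cA.
Qed.

(* Sums over subsets of ['I_n] become computable once the subset is given by
   its characteristic bit sequence. *)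
Definition weight (c : seq int) (s : bitseq) : int := foldr +%R 0 (mask s c).

Lemma weightE (n : nat) (c : seq int) (s : bitseq) :
  size c = n -> size s = n -> \sum_(j < n | nth false s j) c`_j = weight c s.
Proof.
move=> <-; elim: c s => [|x c IHc] [|b s] //=; first by rewrite big_ord0.
case=> ss; rewrite big_mkcond big_ord_recl /= -big_mkcond /= IHc //.
by case: b; rewrite /weight /= ?add0r.
Qed.

Definition bits (n : nat) (S : {set 'I_n}) : bitseq :=
  [seq j \in S | j <- enum 'I_n].

Lemma size_bits (n : nat) (S : {set 'I_n}) : size (bits n S) = n.
Proof. by rewrite size_map size_enum_ord. Qed.

Lemma nth_bits (n : nat) (S : {set 'I_n}) (j : 'I_n) :
  nth false (bits n S) j = (j \in S).
Proof. by rewrite (nth_map j) ?size_enum_ord // nth_ord_enum. Qed.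

Lemma weight_bits (n : nat) (c : seq int) (S : {set 'I_n}) :
  size c = n -> \sum_(j in S) c`_j = weight c (bits n S).
Proof.
move=> sc; rewrite -(weightE n) ?size_bits //.
by apply: eq_bigl => j; rewrite nth_bits.
Qed.

Fixpoint bitseqs (n : nat) : seq bitseq :=
  if n is n'.+1 then [seq b :: s | b <- [:: true; false], s <- bitseqs n']
  else [:: [::]].

Lemma mem_bitseqs (s : bitseq) : s \in bitseqs (size s).
Proof.
elim: s => //= b s IHs.
by rewrite mem_cat; case: b; rewrite ?mem_cat map_f ?orbT.
Qed.

Definition base : seq int := [:: 29; -33; -13; -2; -5; -24; 18; 6; -16; 40]%Z.

Definition perturbation (i : nat) : seq int :=
  nth [::] [:: [:: 4;  0;  2;  2; -2; 0;  0; 0; 0; 0]%Z;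
               [:: 3; -3;  3;  2;  1; 2; -2; 0; 0; 0]%Z;
               [:: 5;  3; -3; -2;  1; 0;  2; 0; 0; 0]%Z] i.

(* The label of the bundle of each item in the maximin partition of agent [i]. *)
Definition mms_label (i : nat) : seq nat :=
  nth [::] [:: [:: 0; 2; 2; 1; 0; 0; 1; 2; 1; 2];
               [:: 0; 0; 1; 0; 1; 2; 1; 0; 2; 2];
               [:: 0; 2; 0; 2; 2; 1; 1; 1; 0; 2]]%N i.

Definition value (R : realType) (i : 'I_3) (j : 'I_10) : R :=
  (11 * base`_j + (perturbation i)`_j)%:~R.

(** The only bundles that agent [i] can hold when everybody receives a positive value. *)
Definition wanted (i : nat) : seq bitseq :=
  [seq s <- bitseqs 10 | (weight base s == 0) && (0 < weight (perturbation i) s)].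

Definition exactly_one (s0 s1 s2 : bitseq) : bool :=
  all (fun j => nth false s0 j + nth false s1 j + nth false s2 j == 1)%N
    (iota 0 10).

Lemma size_perturbation (i : 'I_3) : size (perturbation i) = 10%N.
Proof. by case: i => -[|[|[|]]]. Qed.

Lemma perturbation_le11 (i : 'I_3) (s : bitseq) :
  size s = 10%N -> weight (perturbation i) s <= 11.
Proof.
move=> ss.
have /allP H : all (fun i => all (fun s => weight (perturbation i) s <= 11)
                               (bitseqs 10)) (iota 0 3) by vm_compute.
have /H /allP : nat_of_ord i \in iota 0 3 by rewrite mem_iota /=.
by apply; rewrite -ss mem_bitseqs.
Qed.

(** An exhaustive check. Filtering the bundles of each agent first avoids running through all 2^30
    triples of subsets. *)
Lemma wanted_incompatible (s0 s1 s2 : bitseq) :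
  s0 \in wanted 0 -> s1 \in wanted 1 -> s2 \in wanted 2 ->
  ~~ exactly_one s0 s1 s2.
Proof.
have : all (fun s0 => all (fun s1 => all (fun s2 => ~~ exactly_one s0 s1 s2)
         (wanted 2)) (wanted 1)) (wanted 0) by vm_compute.
by move=> /allP H /H /allP {}H /H /allP {}H /H.
Qed.

Lemma bundle_valueE (R : realType) (i : 'I_3) (S : {set 'I_10}) :
  bundle_value (value R i) S =
  (11 * weight base (bits 10 S) + weight (perturbation i) (bits 10 S))%:~R.
Proof.
rewrite -!weight_bits ?size_perturbation // mulr_sumr -big_split /=.
by rewrite /bundle_value /value rmorph_sum.
Qed.

Lemma weight_mms_bundle (i k : 'I_3) (s := [seq x == val k | x <- mms_label i]) :
  weight base s = 0 /\ weight (perturbation i) s = 2.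
Proof.
rewrite {}/s; case: i k => -[|[|[|]]] // ? [[|[|[|]]]] // ?.
all: by split; vm_compute.
Qed.

Lemma MMS_value_gt0 (R : realType) (i : 'I_3) : 0 < MMS (value R) i.
Proof.
(* Each bundle of the partition [mms_label i] is worth 11 * 0 + 2 to agent [i]. *)
apply: (@lt_le_trans _ _ 2) => //.
have sl : size (mms_label i) = 10%N by case: i => -[|[|[|]]].
pose f (j : 'I_10) : 'I_3 := inord (nth 0%N (mms_label i) j).
have fE j k : (f j == k) = (nth 0%N (mms_label i) j == k).
  rewrite -val_eqE /= inordK //.
  (* [inord] would send a label outside the range to 0. *)
  suff /allP H : all (fun x => x < 3)%N (mms_label i).
    by apply: H; rewrite mem_nth ?sl.
  by case: i {f sl} => -[|[|[|]]].
apply: (MMS_ge _ _ _ (owner_allocation f)) => k; rewrite ffunE bundle_valueE.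
have -> : bits 10 [set j | f j == k] = [seq x == val k | x <- mms_label i].
  apply: (@eq_from_nth _ false) => [|j]; first by rewrite size_bits size_map sl.
  rewrite size_bits => lj; rewrite (nth_bits _ _ (Ordinal lj)) inE fE.
  by rewrite (nth_map 0%N) ?sl.
by have [-> ->] := weight_mms_bundle i k.
Qed.

Lemma allocation_value_le0 (R : realType) (A : {ffun 'I_3 -> {set 'I_10}}) :
  is_allocation A -> ~ forall i, 0 < bundle_value (value R i) (A i).
Proof.
move=> allocA posA.
have pos i : 0 < 11 * weight base (bits 10 (A i))
                 + weight (perturbation i) (bits 10 (A i)).
  by have := posA i; rewrite bundle_valueE ltr0z.
(* Base values are integers, so a negative one would leave a total of at most -11 + 11 = 0. *)
have base_ge0 i : 0 <= weight base (bits 10 (A i)).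
  have := pos i; have := perturbation_le11 i (bits 10 (A i)) (size_bits _ _).
  lia.
(* The base values of the three bundles are nonnegative and add up to the sum of [base], which is 0,
   so each of them vanishes. *)
have /eqP := sum_allocation (fun j : 'I_10 => base`_j) allocA.
under eq_bigr do rewrite weight_bits //.
rewrite [X in _ == X](_ : _ = 0); last first.
  by rewrite !big_ord_recl big_ord0; apply/eqP; vm_compute.
rewrite psumr_eq0 // => /allP base0.
have bw i : bits 10 (A i) \in wanted i.
  have /eqP b0 := base0 i (mem_index_enum i).
  have := mem_bitseqs (bits 10 (A i)); rewrite size_bits mem_filter => ->.
  by have := pos i; rewrite b0 eqxx mulr0 add0r => ->.
(* The third agent is [1 + 1] in the ring ['I_3], with underlying number 2. *)
have /negP := wanted_incompatible _ _ _ (bw 0) (bw 1) (bw (1 + 1)).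
apply; have [f Af] := allocation_owner allocA.
apply/allP => j; rewrite mem_iota /= add0n => lj.
rewrite !(nth_bits _ _ (Ordinal lj)) !Af.
by case: (f _) => -[|[|[|]]].
Qed.

(** Since the maximin shares are positive, so are their multiples by [alpha]. An alpha-MMS
    allocation would thus give every agent a positive value. *)
Lemma no_alpha_MMS (R : realType) (alpha : R) : 0 < alpha <= 1 ->
  ~ exists A : {ffun 'I_3 -> {set 'I_10}},
      is_allocation A /\ is_alpha_MMS (value R) alpha A.
Proof.
case/andP=> alpha_gt0 _ [A [allocA mmsA]].
apply: (allocation_value_le0 R A allocA) => i.
have m0 := MMS_value_gt0 R i.
by apply: lt_le_trans ((mmsA i).1 (ltW m0)); apply: mulr_gt0.
Qed.

Theorem mainTheorem5 (R : realType) :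
  (exists (N M : finType) (v : N -> M -> R),
      (0 < #|N|)%N /\
      forall alpha : R, 0 < alpha <= 1 ->
        ~ exists A : {ffun N -> {set M}},
            is_allocation A /\ is_alpha_MMS v alpha A) /\
  (forall alpha : R, 0 < alpha <= 1 ->
     exists (N M : finType) (v : N -> M -> R),
       (0 < #|N|)%N /\
       ~ exists A : {ffun N -> {set M}},
           is_allocation A /\ is_alpha_MMS v alpha A).
Proof.
split=> [|alpha alpha01]; exists 'I_3, 'I_10, (value R); rewrite card_ord.
  by split=> // alpha; apply: no_alpha_MMS.
by split=> //; apply: no_alpha_MMS.
Qed.
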